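(* Let $X$ be a smooth finite dimensional manifold, let $n\geq 0$ be an integer, and let $E$ be an $(n+1)$-dimensional chain field theory on $X$. Then $E$ is flat if and only if it is invariant under chain deformation.
   Context: Chains: $C_kX$ denotes the group of smooth singular cubical $k$-chains in $X$ (integer coefficients, modulo degenerate cubes), with boundary $\partial$; $Z_kX\subset C_kX$ is the subgroup of cycles. Chain category: $\mathcal{G}=\mathcal{G}_{n+1}X$ has as objects the smooth $n$-cycles $\gamma\in Z_nX$; the set $\mathcal{G}(\gamma,\gamma')$ of morphisms from $\gamma$ to $\gamma'$ consists of the chains $\sigma\in C_{n+1}X$ with $\partial\sigma=-\gamma+\gamma'$; composition is the sum of chains; the identity morphism of every object is the zero chain. It is a symmetric monoidal category with $\otimes$ given by addition of chains on objects and on morphisms, unit object the zero cycle, and all structure isomorphisms identities. $\mathrm{Lines}$ is the category of 1-dimensional complex vector spaces with Hermitian inner product and isometries, symmetric monoidal under tensor product. Chain field theory: an $(n+1)$-dimensional chain field theory on $X$ is a symmetric monoidal functor $E\colon\mathcal{G}_{n+1}X\to\mathrm{Lines}$ (with structure isomorphisms $E(\gamma)\otimes E(\gamma')\to E(\gamma+\gamma')$ and $E(0)\cong\mathbb{C}$) together with a closed smooth complex differential $(n+2)$-form $c$ on $X$ such that for every $\beta\in C_{n+2}X$, $E(\partial\beta)(1)=\exp(2\pi i\int_\beta c)$; here $\partial\beta$ is regarded as a morphism $0\to 0$ and $E(\partial\beta)$ as a unitary map $\mathbb{C}\to\mathbb{C}$ via $E(0)\cong\mathbb{C}$. It is flat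 if $c=0$. $E$ is invariant under chain deformation if, for all objects $\gamma,\gamma'$, all $\sigma_1,\sigma_2\in\mathcal{G}(\gamma,\gamma')$ and all $\beta\in C_{n+2}X$ with $\partial\beta=-\sigma_1+\sigma_2$, one has $E(\sigma_1)=E(\sigma_2)$. *)

(* Defs.v *)
From HB Require Import structures.
From mathcomp Require Import all_boot all_order all_algebra.
From mathcomp Require Import all_classical all_reals all_analysis.
From mathcomp Require Import zify.
From mathcomp.real_closed Require Import complex.
From mathcomp.multinomials Require Import freeg.
Import numFieldNormedType.Exports Order.TTheory GRing.Theory Num.Theory.

Set Implicit Arguments.
Unset Strict Implicit.
Unset Printing Implicit Defensive.

Local Open Scope classical_set_scope.
Local Open Scope ring_scope.
Local Open Scope quotient_scope.
Local Open Scope complex_scope.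

Section Smoothness.
Context {R : realType} {m : nat} {W : normedModType R}.

Fixpoint Cn (k : nat) (U : set 'rV[R]_m) (f : 'rV[R]_m -> W) : Prop :=
  if k is k'.+1 then
    (forall x, U x -> differentiable f x) /\
    (forall v : 'rV[R]_m, Cn k' U (fun x => 'D_v f x))
  else forall x, U x -> {for x, continuous f}.

Definition smooth_on (U : set 'rV[R]_m) (f : 'rV[R]_m -> W) : Prop :=
  open U /\ forall k, Cn k U f.

End Smoothness.

(* [chart] indexes a smooth atlas.  The values of [chart_coord i] matter     *)
(* only on [chart_domain i], and those of its inverse [chart_param i] only   *)
(* on the image of [chart_domain i].                                         *)
Record manifold (R : realType) (d : nat) := Manifold {
  manifold_sort :> topologicalType;
  manifold_hausdorff : hausdorff_space manifold_sort;
  manifold_second_countable : @second_countable manifold_sort;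
  chart : Type;
  chart_domain : chart -> set manifold_sort;
  chart_coord : chart -> manifold_sort -> 'rV[R]_d;
  chart_param : chart -> 'rV[R]_d -> manifold_sort;
  chart_at : manifold_sort -> chart;
  mem_chart_at : forall p, chart_domain (chart_at p) p;
  open_chart_domain : forall i, open (chart_domain i);
  open_chart_range : forall i, open (chart_coord i @` chart_domain i);
  chart_coordK : forall i p,
    chart_domain i p -> chart_param i (chart_coord i p) = p;
  chart_coord_continuous : forall i p,
    chart_domain i p -> {for p, continuous (chart_coord i)};
  chart_param_continuous : forall i x,
    (chart_coord i @` chart_domain i) x -> {for x, continuous (chart_param i)};
  transition_smooth : forall i j,
    smooth_on (chart_coord i @` (chart_domain i `&` chart_domain j))
      (chart_coord j \o chart_param i)
}.

Section Cubes.
Context (R : realType).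

Definition in_cube k (x : 'rV[R]_k) : bool := [forall i, 0 <= x 0 i <= 1].
Definition icube k := {x : 'rV[R]_k | in_cube x}.

Definition coord_insert k (i : 'I_k.+1) (t : R) (x : 'rV[R]_k) : 'rV[R]_k.+1 :=
  \row_j (if unlift i j is Some j' then x 0 j' else t).

Lemma insert_at k (i : 'I_k.+1) t (x : 'rV[R]_k) : coord_insert i t x 0 i = t.
Proof. by rewrite mxE unlift_none. Qed.

Lemma insert_lift k (i : 'I_k.+1) t (x : 'rV[R]_k) j :
  coord_insert i t x 0 (fintype.lift i j) = x 0 j.
Proof. by rewrite mxE liftK. Qed.

Lemma insert_in_cube k (i : 'I_k.+1) (b : bool) (x : icube k) :
  in_cube (coord_insert i b%:R (val x)).
Proof.
apply/forallP => j; rewrite mxE; case: unliftP => [j' _|_].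
  by have /forallP := valP x.
by case: b; rewrite /= ?lexx ler01.
Qed.

Definition cube_insert k (i : 'I_k.+1) (b : bool) (x : icube k) : icube k.+1 :=
  exist (fun y => in_cube y) _ (insert_in_cube i b x).

Definition clamp_row k (x : 'rV[R]_k) : 'rV[R]_k :=
  \row_i Num.max 0 (Num.min 1 (x 0 i)).

Lemma clamp_in_cube k (x : 'rV[R]_k) : in_cube (clamp_row x).
Proof.
by apply/forallP => i; rewrite mxE le_max lexx /= ge_max ler01 ge_min lexx.
Qed.

Definition clamp k (x : 'rV[R]_k) : icube k :=
  exist (fun y => in_cube y) _ (clamp_in_cube x).

End Cubes.

Section Chains.
Context (R : realType) (d : nat) (X : manifold R d).

(* Smoothness on the closed cube: near each of its points the map is, in     *)
(* some chart, the restriction of a smooth map on an open set of R^k.        *)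
Definition smooth_cube k (s : icube R k -> X) : Prop :=
  forall p : icube R k, exists (i : chart X) (U : set 'rV[R]_k)
      (g : 'rV[R]_k -> 'rV[R]_d),
    [/\ U (val p), smooth_on U g &
        forall q : icube R k, U (val q) ->
          chart_domain i (s q) /\ chart_coord i (s q) = g (val q)].

Record cube k := Cube {
  cube_fun :> icube R k -> X;
  cube_smooth : smooth_cube cube_fun
}.

HB.instance Definition _ k := gen_eqMixin (cube k).
HB.instance Definition _ k := gen_choiceMixin (cube k).

Lemma cubeP k (s t : cube k) : s =1 t -> s = t.
Proof.
case: s t => [s sP] [t tP] /= /funext st; move: sP tP; rewrite st => sP tP.
by congr Cube; exact: Prop_irrelevance.
Qed.

Lemma insert_affine k (i : 'I_k.+1) t h (v x : 'rV[R]_k) :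
  coord_insert i t (h *: v + x) = h *: coord_insert i 0 v + coord_insert i t x.
Proof.
by apply/rowP => j; rewrite !mxE; case: unlift => [l|];
  rewrite ?mxE ?mulr0 ?add0r.
Qed.

Lemma derive_insert k (i : 'I_k.+1) t (W : normedModType R)
    (g : 'rV[R]_k.+1 -> W) (v x : 'rV[R]_k) :
  'D_v (g \o coord_insert i t) x =
  'D_(coord_insert i 0 v) g (coord_insert i t x).
Proof.
rewrite /derive /=; set F := fun _ => _; set G := fun _ => _.
suff -> : F = G by [].
by apply/funext => h; rewrite /F /G /= insert_affine.
Qed.

Lemma insert_linear k (i : 'I_k.+1) : linear (@coord_insert R k i 0).
Proof.
move=> a x y; apply/rowP => j; rewrite !mxE.
by case: unlift => [l|]; rewrite ?mxE ?mulr0 ?addr0.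
Qed.

Lemma insert_continuous k (i : 'I_k.+1) t : continuous (@coord_insert R k i t).
Proof.
move=> x.
apply: (proj2 (@cvg_ballP _ _ _ _ (@nbhs_filter 'rV[R]_k x) _ _)) => e e0.
apply: (@filterS _ _ (@nbhs_filter 'rV[R]_k x) _ _ _ (nbhsx_ballx x e e0)).
move=> y [_ xy]; split=> // a j.
by rewrite !mxE; case: unlift => [l|]; [exact: xy|exact: ballxx].
Qed.

Lemma insert_differentiable k (i : 'I_k.+1) t x :
  differentiable (@coord_insert R k i t) x.
Proof.
pose L := HB.pack_for {linear 'rV[R]_k -> 'rV[R]_k.+1} (@coord_insert R k i 0)
  (GRing.isLinear.Build _ _ _ _ _ (@insert_linear k i)).
have -> : coord_insert i t = (fun y => L y + coord_insert i t 0).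
  by apply/funext => y; rewrite -[y in LHS]addr0 -[y in LHS]scale1r
    insert_affine scale1r.
apply: differentiableD => //.
apply: (@linear_differentiable _ _ _ L) => y; exact: insert_continuous.
Qed.

Lemma Cn_insert k (i : 'I_k.+1) t (W : normedModType R) (U : set 'rV[R]_k.+1)
    n (g : 'rV[R]_k.+1 -> W) :
  Cn n U g -> Cn n (coord_insert i t @^-1` U) (g \o coord_insert i t).
Proof.
elim: n g => [|n IHn] g /=.
  move=> gU x /gU gx; apply: continuous_comp => //; exact: insert_continuous.
move=> [gdiff gD]; split=> [x /gdiff gx|v].
  by apply: differentiable_comp => //; exact: insert_differentiable.
have -> : (fun x => 'D_v (g \o coord_insert i t) x) =
          (fun y => 'D_(coord_insert i 0 v) g y) \o coord_insert i t.
  by apply/funext => x; exact: derive_insert.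
exact/IHn/gD.
Qed.

Lemma smooth_face k (s : cube k.+1) (i : 'I_k.+1) (b : bool) :
  smooth_cube (s \o cube_insert i b).
Proof.
move=> p; have [l [U [g [Up [Uo gU] sg]]]] := cube_smooth s (cube_insert i b p).
exists l, (coord_insert i b%:R @^-1` U), (g \o coord_insert i b%:R); split=> //.
- split=> [|n]; last exact/Cn_insert/gU.
  by apply: open_comp => // x _; exact: insert_continuous.
- by move=> q Uq; exact: sg (cube_insert i b q) Uq.
Qed.

Definition face k (s : cube k.+1) (i : 'I_k.+1) (b : bool) : cube k :=
  Cube (smooth_face s i b).

(* Independent of one of the coordinates; no 0-cube is degenerate.           *)
Definition degenerate k (s : cube k) : Prop :=
  exists i : 'I_k, forall x y : icube R k,
    (forall j, j != i -> val x 0 j = val y 0 j) -> s x = s y.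

Definition free_chain k := {freeg (cube k) / int}.

(* The subgroup generated by the degenerate cubes: the chains supported on   *)
(* them.                                                                     *)
Definition degenerate_chain k : {pred free_chain k} :=
  fun a => all (fun s => `[< degenerate s >]) (dom a).

Fact degenerate_chain_zmod k : zmod_closed (@degenerate_chain k).
Proof.
split=> [|a b /allP aD /allP bD]; rewrite !unfold_in.
  by rewrite dom0.
by apply/allP => s /domB; rewrite mem_cat => /orP[/aD|/bD].
Qed.

HB.instance Definition _ k :=
  GRing.isZmodClosed.Build (free_chain k) (@degenerate_chain k)
    (degenerate_chain_zmod k).

Definition chain k := Quotient.quot (@degenerate_chain k).

(* The sign makes the boundary of a 1-cube its end point minus its starting  *)
(* point.                                                                    *)
Definition cube_boundary k (s : cube k.+1) : free_chain k :=
  \sum_(i < k.+1) (-1) ^+ i *: (<< face s i true >> - << face s i false >>).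

Definition free_boundary k : free_chain k.+1 -> free_chain k :=
  fglift (@cube_boundary k).

HB.instance Definition _ k := GRing.isZmodMorphism.Build
  (free_chain k.+1) (free_chain k) (@free_boundary k) (lift_is_additive _).

Definition boundary k (a : chain k.+1) : chain k :=
  \pi_(chain k) (free_boundary (repr a)).

Lemma fgliftE (K : choiceType) (M : lmodType int) (f : K -> M)
    (a : {freeg K / int}) :
  fglift f a = \sum_(z <- dom a) coeff z a *: f z.
Proof. by rewrite -[a in LHS]Freeg_dom fglift_Freeg /prelift big_map. Qed.

Lemma free_boundaryZ k z (a : free_chain k.+1) :
  free_boundary (z *: a) = z *: free_boundary a.
Proof. by rewrite -[z]intz !scaler_int raddfMz. Qed.

Lemma lift_commute k (i i2 : 'I_k.+2) (j j2 : 'I_k.+1) (l : 'I_k) :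
  fintype.lift i j = i2 -> fintype.lift i2 j2 = i ->
  fintype.lift i (fintype.lift j l) = fintype.lift i2 (fintype.lift j2 l).
Proof.
move=> /(congr1 val) /= ij /(congr1 val) /= ji; apply/val_inj => /=.
by move: ij ji; rewrite /bump; lia.
Qed.

Lemma face_face k (s : cube k.+2) (i i2 : 'I_k.+2) (j j2 : 'I_k.+1) b c :
  fintype.lift i j = i2 -> fintype.lift i2 j2 = i ->
  face (face s i b) j c = face (face s i2 c) j2 b.
Proof.
move=> ij ji; apply: cubeP => x /=; congr (s _); apply/val_inj/rowP => l /=.
have [l' ->|->] := unliftP i l; last first.
  by rewrite insert_at -ji insert_lift insert_at.
rewrite insert_lift; have [m ->|->] := unliftP j l'; last first.
  by rewrite insert_at ij insert_at.
by rewrite insert_lift (lift_commute _ ij ji) !insert_lift.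
Qed.

Lemma degenerate_face k (s : cube k.+1) (i : 'I_k.+1) :
  (forall x y : icube R k.+1,
    (forall j, j != i -> val x 0 j = val y 0 j) -> s x = s y) ->
  face s i true = face s i false /\
  forall j b, j != i -> degenerate (face s j b).
Proof.
move=> si; split.
  apply: cubeP => x; apply: si => j; rewrite eq_sym => /unlift_some[l -> _] /=.
  by rewrite !insert_lift.
move=> j b ji; have [l il _] := unlift_some ji.
exists l => x y xy; apply: si => m mi /=.
have [m' em|->] := unliftP j m; last by rewrite !insert_at.
rewrite em !insert_lift; apply: xy; apply/eqP => ml.
by move/eqP: mi; apply; rewrite em ml il.
Qed.

Lemma degenerate_chainU k (s : cube k) :
  degenerate s -> << s >> \in @degenerate_chain k.
Proof. by move=> sd; rewrite unfold_in domU1 /= andbT; exact/asboolP. Qed.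

Lemma degenerate_chainZ k z (a : free_chain k) :
  a \in @degenerate_chain k -> z *: a \in @degenerate_chain k.
Proof. by move=> ad; rewrite -[z]intz scaler_int rpredMz. Qed.

Lemma cube_boundary_degenerate k (s : cube k.+1) :
  degenerate s -> cube_boundary s \in @degenerate_chain k.
Proof.
move=> [i /degenerate_face[si sj]]; apply: rpred_sum => j _.
apply: degenerate_chainZ; have [->|ji] := eqVneq j i.
  by rewrite si subrr rpred0.
by apply: rpredB; apply/degenerate_chainU/sj.
Qed.

Lemma free_boundary_degenerate k (a : free_chain k.+1) :
  a \in @degenerate_chain k.+1 -> free_boundary a \in @degenerate_chain k.
Proof.
rewrite unfold_in => /allP ad; rewrite /free_boundary fgliftE big_seq.
apply: rpred_sum => s /ad /asboolP sd.
exact/degenerate_chainZ/cube_boundary_degenerate.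
Qed.

Lemma chain_eqP k (a b : free_chain k) :
  reflect (\pi_(chain k) a = \pi_(chain k) b) (a - b \in @degenerate_chain k).
Proof. by rewrite Quotient.idealrBE; exact: eqP. Qed.

Lemma boundary_pi k (a : free_chain k.+1) :
  boundary (\pi_(chain k.+1) a) = \pi_(chain k) (free_boundary a).
Proof.
apply/chain_eqP; rewrite -raddfB; apply/free_boundary_degenerate/chain_eqP.
by rewrite reprK.
Qed.

Fact boundary_zmod_morphism k : zmod_morphism (@boundary k).
Proof.
move=> a b; rewrite -[a]reprK -[b]reprK -raddfB !boundary_pi.
by rewrite !raddfB.
Qed.

HB.instance Definition _ k := GRing.isZmodMorphism.Build
  (chain k.+1) (chain k) (@boundary k) (@boundary_zmod_morphism k).

Lemma alternating_sum0 (V : lmodType int) k (T : 'I_k.+2 -> 'I_k.+1 -> V) :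
  (forall i i2 j j2, fintype.lift i j = i2 -> fintype.lift i2 j2 = i ->
    T i j = T i2 j2) ->
  \sum_(i < k.+2) \sum_(j < k.+1) (-1) ^+ (i + j) *: T i j = 0.
Proof.
move=> TT; pose e (p : 'I_k.+2 * 'I_k.+1) :=
  (fintype.lift p.1 p.2, odflt ord0 (unlift (fintype.lift p.1 p.2) p.1)).
have eP p :
    fintype.lift p.1 p.2 = (e p).1 /\ fintype.lift (e p).1 (e p).2 = p.1.
  split=> //=; have /unlift_some[l pl ->] : fintype.lift p.1 p.2 != p.1.
    by rewrite eq_sym neq_lift.
  by rewrite /= -pl.
have eK : involutive e.
  move=> p; have [p1 p2] := eP p; rewrite {1}/e p2 -p1 liftK /=.
  by case: p {p1 p2}.
have e_lt p : ((e p).2 < (e p).1)%N = ~~ (p.2 < p.1)%N.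
  move: (e p) (eP p) => q [/(congr1 val)/= + /(congr1 val)/=].
  by rewrite /bump; lia.
have e_sign p : (-1) ^+ ((e p).1 + (e p).2) = - (-1) ^+ (p.1 + p.2) :> int.
  move: (e p) (eP p) => q [/(congr1 val)/= + /(congr1 val)/=].
  rewrite /bump => h1 h2.
  have [->|->] : (q.1 + q.2 = (p.1 + p.2).+1 \/
                  (p.1 + p.2) = (q.1 + q.2).+1)%N by move: h1 h2; lia.
    by rewrite exprS mulN1r.
  by rewrite exprS mulN1r opprK.
rewrite pair_big /= (bigID (fun p : 'I_k.+2 * 'I_k.+1 => (p.2 < p.1)%N)) /=.
rewrite [X in _ + X](reindex_inj (inv_inj eK)) /=.
rewrite [X in _ + X](eq_big (fun p : 'I_k.+2 * 'I_k.+1 => (p.2 < p.1)%N)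
  (fun p => - ((-1) ^+ (p.1 + p.2) *: T p.1 p.2))).
- by rewrite sumrN subrr.
- by move=> p; rewrite e_lt negbK.
- move=> p _; have [p1 p2] := eP p.
  by rewrite e_sign scaleNr (TT _ _ _ _ p1 p2).
Qed.

Lemma cube_boundaryK k (s : cube k.+2) : free_boundary (cube_boundary s) = 0.
Proof.
pose H i j b c : free_chain k := << face (face s i b) j c >>.
pose T i j := (H i j true true - H i j true false) -
              (H i j false true - H i j false false).
rewrite -[RHS](@alternating_sum0 _ k T); last first.
  move=> i i2 j j2 ij ji; rewrite /T /H !(face_face _ _ _ ij ji) !opprB.
  by rewrite addrACA [RHS]addrACA; congr (_ + _); rewrite addrC.
rewrite /cube_boundary raddf_sum /=; apply: eq_bigr => i _.
rewrite free_boundaryZ raddfB /= /free_boundary !liftU !scale1r.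
rewrite /cube_boundary -sumrB scaler_sumr; apply: eq_bigr => j _.
by rewrite -scalerBr scalerA -exprD.
Qed.

Lemma boundaryK k (a : chain k.+2) : boundary (boundary a) = 0.
Proof.
rewrite -[a]reprK !boundary_pi [X in free_boundary X]fgliftE raddf_sum /=.
rewrite big1 ?raddf0 // => s _.
by rewrite free_boundaryZ cube_boundaryK scaler0.
Qed.

(* Every 0-chain is a cycle.                                                 *)
Definition is_cycle k : {pred chain k} :=
  match k with 0 => predT | k'.+1 => fun a : chain k'.+1 => boundary a == 0 end.

Fact is_cycle_zmod k : zmod_closed (@is_cycle k).
Proof.
case: k => [|k]; split=> // [|a b /eqP a0 /eqP b0]; apply/eqP.
  exact: raddf0.
by rewrite [LHS]raddfB /= a0 b0 subrr.
Qed.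

HB.instance Definition _ k :=
  GRing.isZmodClosed.Build (chain k) (@is_cycle k) (is_cycle_zmod k).

Record cycle k := Cycle { cycle_val : chain k; _ : cycle_val \in @is_cycle k }.

HB.instance Definition _ k := [isSub for @cycle_val k].
HB.instance Definition _ k := [Choice of cycle k by <:].
HB.instance Definition _ k := [SubChoice_isSubZmodule of cycle k by <:].

End Chains.

Section Forms.
Context (R : realType) (d : nat) (X : manifold R d).

Definition chart_range (i : chart X) : set 'rV[R]_d :=
  chart_coord i @` chart_domain i.

(* A k-tuple of vectors of R^d is the list of rows of a matrix.              *)
Definition multilinear k (w : 'M[R]_(k, d) -> R[i]) : Prop :=
  forall (A B C : 'M[R]_(k, d)) (i : 'I_k) (a b : R),
    row i A = a *: row i B + b *: row i C ->
    row' i B = row' i A -> row' i C = row' i A ->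
    w A = a%:C * w B + b%:C * w C.

Definition alternating k (w : 'M[R]_(k, d) -> R[i]) : Prop :=
  forall (A : 'M[R]_(k, d)) (i j : 'I_k),
    i != j -> row i A = row j A -> w A = 0.

(* A smooth complex k-form, given by its expressions in the charts; only the *)
(* values of [form_at i] on [chart_range i] are meaningful.                  *)
Record diff_form k := DiffForm {
  form_at : chart X -> 'rV[R]_d -> 'M[R]_(k, d) -> R[i];
  form_multilinear : forall i x, chart_range i x -> multilinear (form_at i x);
  form_alternating : forall i x, chart_range i x -> alternating (form_at i x);
  form_smooth : forall i v,
    smooth_on (chart_range i) (fun x => complex.Re (form_at i x v) : R^o) /\
    smooth_on (chart_range i) (fun x => complex.Im (form_at i x v) : R^o);
  form_transition : forall i j p v, chart_domain i p -> chart_domain j p ->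
    form_at i (chart_coord i p) v =
    form_at j (chart_coord j p)
      (v *m jacobian (chart_coord j \o chart_param i) (chart_coord i p))
}.

Definition form_eq0 k (w : diff_form k) : Prop :=
  forall i x v, chart_range i x -> form_at w i x v = 0.

Definition complex_derive (f : 'rV[R]_d -> R[i]) (x u : 'rV[R]_d) : R[i] :=
  'D_u (fun y => complex.Re (f y) : R^o) x +i*
  'D_u (fun y => complex.Im (f y) : R^o) x.

Definition exterior_derivative k (w : diff_form k) (i : chart X) (x : 'rV[R]_d)
    (v : 'M[R]_(k.+1, d)) : R[i] :=
  \sum_(j < k.+1) (-1) ^+ j *
    complex_derive (fun y => form_at w i y (row' j v)) x (row j v).

Definition closed_form k (w : diff_form k) : Prop :=
  forall i x v, chart_range i x -> exterior_derivative w i x v = 0.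

(* The coefficient of dx_1 ... dx_k in the pullback of [w] along [s].  It is *)
(* only used inside the open cube, where [clamp] is locally the identity.    *)
Definition pullback k (w : diff_form k) (s : cube X k) (x : 'rV[R]_k) : R[i] :=
  let i := chart_at (s (clamp x)) in
  form_at w i (chart_coord i (s (clamp x)))
    (jacobian (fun y : 'rV[R]_k => chart_coord i (s (clamp y))) x).

Fixpoint open_cube_integral k : ('rV[R]_k -> R) -> R :=
  match k return ('rV[R]_k -> R) -> R with
  | 0 => fun f => f 0
  | k'.+1 => fun f => \int[lebesgue_measure]_(t in `]0%R, 1%R[)
      open_cube_integral (fun x : 'rV[R]_k' => f (row_mx (t%:M : 'rV_1) x))
  end.

Definition cube_integral k (w : diff_form k) (s : cube X k) : R[i] :=
  open_cube_integral (fun x => complex.Re (pullback w s x)) +i*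
  open_cube_integral (fun x => complex.Im (pullback w s x)).

Definition free_integral k (w : diff_form k) (a : free_chain X k) : R[i] :=
  \sum_(s <- dom a) cube_integral w s *~ coeff s a.

Definition chain_integral k (w : diff_form k) (a : chain X k) : R[i] :=
  free_integral w (repr a).

(* The integral descends to chains modulo degenerate cubes.                  *)
Lemma pullback_degenerate k (w : diff_form k) (s : cube X k) x :
  degenerate s -> pullback w s x = 0.
Proof.
move=> [i si]; rewrite /pullback; set c := chart_at _; set f := fun y => _.
have fi h : f (h *: delta_mx 0 i + x) = f x.
  congr (chart_coord _ _); apply: si => j ji /=.
  by rewrite !mxE (negbTE ji) andbF mulr0 add0r.
have row0 : row i (jacobian f x) = 0.
  rewrite rowE mul_rV_lin1.
  have [fx|Nfx] := pselect (differentiable f x).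
    rewrite -deriveE // /derive; apply/cvg_lim => //.
    apply: cvg_near_cst; near=> h.
    by rewrite /= fi subrr scaler0.
  rewrite /diff; set P := (X in get X).
  have [[df dfP]|NP] := pselect (exists df, P df).
    by case: Nfx; apply/diffP; exact: (getPex (ex_intro P df dfP)).
  by rewrite getPN // => df dfP; apply: NP; exists df.
have wA := form_multilinear w
  (ex_intro2 _ _ (s (clamp x)) (mem_chart_at (s (clamp x))) erefl).
by rewrite (wA _ (jacobian f x) (jacobian f x) i 0 0) ?mul0r ?addr0 //
  row0 !scale0r addr0.
Unshelve. all: by end_near. Qed.

Lemma cube_integral_degenerate k (w : diff_form k) (s : cube X k) :
  degenerate s -> cube_integral w s = 0.
Proof.
have I0 m : open_cube_integral (fun _ : 'rV[R]_m => 0) = 0.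
  elim: m => //= m IHm.
  by rewrite IHm Rintegral_cst // mul0r.
move=> sd; rewrite /cube_integral.
have -> : pullback w s = fun=> 0.
  by apply/funext => x; exact: pullback_degenerate.
by rewrite !I0.
Qed.

Fact free_integral_zmod_morphism k (w : diff_form k) :
  zmod_morphism (free_integral w).
Proof.
have E a : free_integral w a =
    fglift (cube_integral w : _ -> ssrint.zmodule R[i]) a.
  by rewrite fgliftE.
by move=> a b; rewrite !E lift_is_additive.
Qed.

HB.instance Definition _ k (w : diff_form k) := GRing.isZmodMorphism.Build
  (free_chain X k) R[i] (free_integral w) (free_integral_zmod_morphism w).

Lemma chain_integral_pi k (w : diff_form k) (a : free_chain X k) :
  chain_integral w (\pi_(chain X k) a) = free_integral w a.
Proof.
apply/eqP; rewrite /chain_integral -subr_eq0 -raddfB /=; apply/eqP.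
have : repr (\pi_(chain X k) a) - a \in @degenerate_chain _ _ X k.
  by apply/chain_eqP; rewrite reprK.
rewrite unfold_in => /allP ad; rewrite /free_integral big_seq big1 // => s.
by move=> /ad /asboolP sd; rewrite cube_integral_degenerate // mul0rz.
Qed.

End Forms.

Definition cexp (R : realType) (z : R[i]) : R[i] :=
  (expR (complex.Re z))%:C * (cos (complex.Im z) +i* sin (complex.Im z)).

Section Lines.
Context (R : realType).

Record line := Line {
  line_space :> vectType R[i];
  line_dim : \dim {: line_space} = 1%N;
  line_dot : {dot line_space for @Num.conj R[i]}
}.

Record line_isometry (L M : line) := LineIsometry {
  isometry_fun :> {linear L -> M};
  isometry_dot : isometry (line_dot M) (line_dot L) isometry_fun
}.

End Lines.

Section ChainCategory.
Context (R : realType) (d : nat) (X : manifold R d) (n : nat).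

Definition obj := cycle X n.

Definition mor (g h : obj) :=
  {a : chain X n.+1 | boundary a == - val g + val h}.

Fact mor_eq_subproof (g h : obj) :
  g = h -> boundary (0 : chain X n.+1) == - val g + val h.
Proof. by move=> ->; rewrite raddf0 addNr. Qed.

(* The zero chain; the identities and all structure isomorphisms are of this *)
(* form.                                                                     *)
Definition mor_eq (g h : obj) (gh : g = h) : mor g h :=
  exist _ 0 (mor_eq_subproof gh).

Definition mor_id (g : obj) : mor g g := mor_eq (erefl g).

Fact mor_comp_subproof (g h k : obj) (a : mor g h) (b : mor h k) :
  boundary (val a + val b) == - val g + val k.
Proof.
case: a b => [a /= /eqP aP] [b /= /eqP bP].
by rewrite raddfD /= aP bP addrA addrK.
Qed.

Definition mor_comp (g h k : obj) (a : mor g h) (b : mor h k) : mor g k :=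
  exist _ (val a + val b) (mor_comp_subproof a b).

Fact mor_tensor_subproof (g h g' h' : obj) (a : mor g h) (b : mor g' h') :
  boundary (val a + val b) == - val (g + g') + val (h + h').
Proof.
case: a b => [a /= /eqP aP] [b /= /eqP bP].
by rewrite raddfD /= aP bP addrACA -opprD.
Qed.

Definition mor_tensor (g h g' h' : obj) (a : mor g h) (b : mor g' h') :
    mor (g + g') (h + h') :=
  exist _ (val a + val b) (mor_tensor_subproof a b).

Fact mor_boundary_subproof (b : chain X n.+2) :
  boundary (boundary b) == - val (0 : obj) + val (0 : obj).
Proof. by rewrite boundaryK addNr. Qed.

Definition mor_boundary (b : chain X n.+2) : mor 0 0 :=
  exist _ (boundary b) (mor_boundary_subproof b).

(* Symmetric monoidal functors to lines.  A linear map out of L (x) M is     *)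
(* given by the corresponding bilinear map on L x M; as the inner product of *)
(* L (x) M satisfies <u (x) v, u' (x) v'> = <u, u'> <v, v'>, it is isometric *)
(* exactly when [fun_tensor_dot] holds.  The coherence diagrams are written  *)
(* on pure tensors, and the isometry C -> E(0) is [fun_unit].                *)
Record sym_monoidal_functor := SymMonoidalFunctor {
  fun_obj :> obj -> line R;
  fun_mor : forall g h, mor g h -> line_isometry (fun_obj g) (fun_obj h);
  fun_mor_id : forall g, fun_mor (mor_id g) =1 id;
  fun_mor_comp : forall g h k (a : mor g h) (b : mor h k),
    fun_mor (mor_comp a b) =1 fun_mor b \o fun_mor a;
  fun_tensor : forall g h,
    {bilinear (fun_obj g) -> (fun_obj h) -> (fun_obj (g + h)%R)};
  fun_tensor_dot : forall g h u u' v v',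
    line_dot (fun_obj (g + h)) (fun_tensor g h u v) (fun_tensor g h u' v') =
    line_dot (fun_obj g) u u' * line_dot (fun_obj h) v v';
  fun_tensor_natural : forall g h g' h' (a : mor g h) (b : mor g' h') u v,
    fun_mor (mor_tensor a b) (fun_tensor g g' u v) =
    fun_tensor h h' (fun_mor a u) (fun_mor b v);
  fun_unit : {linear R[i]^o -> fun_obj 0};
  fun_unit_dot : forall z w,
    line_dot (fun_obj 0) (fun_unit z) (fun_unit w) = z * Num.conj w;
  fun_assoc : forall g h k u v w,
    fun_mor (mor_eq (esym (addrA g h k)))
      (fun_tensor (g + h) k (fun_tensor g h u v) w) =
    fun_tensor g (h + k) u (fun_tensor h k v w);
  fun_unitl : forall g u,
    fun_mor (mor_eq (add0r g)) (fun_tensor 0 g (fun_unit 1) u) = u;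
  fun_unitr : forall g u,
    fun_mor (mor_eq (addr0 g)) (fun_tensor g 0 u (fun_unit 1)) = u;
  fun_sym : forall g h u v,
    fun_mor (mor_eq (addrC g h)) (fun_tensor g h u v) = fun_tensor h g v u
}.

Record chain_field_theory := ChainFieldTheory {
  theory_fun :> sym_monoidal_functor;
  curvature : diff_form X n.+2;
  curvature_closed : closed_form curvature;
  holonomy : forall b : chain X n.+2,
    fun_mor theory_fun (mor_boundary b) (fun_unit theory_fun 1) =
    fun_unit theory_fun (cexp ((0 +i* (2 * pi)) * chain_integral curvature b))
}.

Definition flat (E : chain_field_theory) : Prop := form_eq0 (curvature E).

Definition deformation_invariant (E : chain_field_theory) : Prop :=
  forall (g h : obj) (a1 a2 : mor g h) (b : chain X n.+2),
    boundary b = - val a1 + val a2 -> fun_mor E a1 =1 fun_mor E a2.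

End ChainCategory.

(* Main.v *)
Require Import Defs.
From mathcomp Require Import all_boot all_order all_algebra.
From mathcomp Require Import all_classical all_reals all_analysis.
From mathcomp Require Import ring lra.
From mathcomp.real_closed Require Import complex.
From mathcomp.multinomials Require Import freeg.
Import numFieldNormedType.Exports Order.TTheory GRing.Theory Num.Theory.

Set Implicit Arguments.
Unset Strict Implicit.
Unset Printing Implicit Defensive.

Local Open Scope classical_set_scope.
Local Open Scope ring_scope.
Local Open Scope complex_scope.

(** Two morphisms [a1] and [a2] joined by a deformation [b] differ by the
boundary of [b].  Since composition and tensor product of morphisms are both
the sum of chains, [a2] is, up to unit isomorphisms, the tensor product of
[boundary b : 0 -> 0] with [a1]; hence [E a1 = E a2] as soon as
[E (boundary b)] fixes the unit vector of [E 0] ([fun_mor_shift]).  If the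
curvature [c] vanishes, so do all its integrals, and [E (boundary b)] is the
identity by the holonomy formula.

Conversely, invariance compares [boundary b : 0 -> 0] with the identity of
[0], so [exp (2 i pi z) = 1] for every integral [z] of [c] over a chain: [z] is
real and does not lie strictly between 0 and 1 ([cexp_2ipi_eq1]).  If [c] were
nonzero at a point, on vectors [v_1, .., v_k], integrate it over the
parallelepiped spanned in a chart by [a v_1, .., a v_k] for a small [a > 0].
There the pullback of [c] is [a ^ k] times a function close to its nonzero
value at the point ([pullback_parallelepiped]), so that, after a change of
sign of [v_1] if necessary, the real or the imaginary part of the integral is
strictly between 0 and 1 ([small_cube_integral]): a contradiction.

Only bounds on the integrals are used, and they follow from bounds on the
integrand, because the integral of nonnegative functions is monotone
([le_ge0_integral]); the value of the pullback on the boundary of the cube,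
where it is not controlled, never enters. *)

(** * Analytic preliminaries *)

Section Real.
Context {R : realType}.

(** The differential is determined by the germ of the function, because the
little-o expansion that characterizes it is. *)
Lemma diff_near_eq (V W : normedModType R) (f g : V -> W) (x : V) :
  differentiable f x -> (\forall y \near x, f y = g y) ->
  'd g x = 'd f x :> (V -> W).
Proof.
move=> fx fg; apply: diff_unique; first exact: diff_continuous.
apply/eqaddoP => e e0.
have /eqaddoP/(_ e e0) := diff_locally fx.
have fg0 : \forall h \near (0 : V), f (h + x) = g (h + x).
  by move: fg; rewrite (near_shift 0 x); apply: filterS => h /=; rewrite subr0.
have fgx : f x = g x by exact: nbhs_singleton fg.
rewrite !nearE; apply: filter_app; apply: filterS fg0 => h fgh.
by rewrite !fctE /= -fgh -fgx.
Qed.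

Section MonotoneIntegral.
Local Open Scope ereal_scope.

(** The integral of a nonnegative function is the supremum of the integrals of
the simple functions below it, and so is monotone even between functions that
are not known to be measurable. *)
Lemma le_ge0_integral d (T : measurableType d) (mu : {measure set T -> \bar R})
    (D : set T) (f g : T -> \bar R) :
  (forall x, D x -> 0 <= f x) -> (forall x, D x -> f x <= g x) ->
  \int[mu]_(x in D) f x <= \int[mu]_(x in D) g x.
Proof.
move=> f0 fg; rewrite !ge0_integralE //; last first.
  by move=> x Dx; exact: le_trans (f0 x Dx) (fg x Dx).
apply: ereal_sup_le => _ [h hf <-]; exists h => // x.
apply: (le_trans (hf x)); rewrite /patch; case: ifPn => // xD.
by apply: fg; rewrite inE in xD.
Qed.

End MonotoneIntegral.

(** Each of the iterated integrals is an average over an interval of length 1,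
so that bounds pass from the integrand to the integral one variable at a time.
The lower bound has to be nonnegative for [le_ge0_integral] to apply. *)
Lemma open_cube_integral_itv k (f : 'rV[R]_k -> R) (m M : R) :
  0 <= m ->
  (forall x : 'rV[R]_k, (forall i, 0 < x 0 i < 1) -> m <= f x <= M) ->
  m <= open_cube_integral f <= M.
Proof.
move=> m0; elim: k f => [|k IHk] f fmM; first by apply: fmM => -[].
have slice t : `]0, 1[%classic t -> m <= open_cube_integral
    (fun x : 'rV[R]_k => f (row_mx (t%:M : 'rV_1) x)) <= M.
  rewrite /= in_itv /= => t01; apply: IHk => x x01; apply: fmM => i.
  rewrite !mxE; case: splitP => j _; last exact: x01.
  by rewrite (ord1 j) mxE eqxx mulr1n.
rewrite /=; set g := fun t => open_cube_integral _ in slice *.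
have Ic (c : R) : (\int[lebesgue_measure]_(t in `]0%R, 1%R[) (cst c%:E t) = c%:E)%E.
  by rewrite integral_cst //= lebesgue_measure_itv /= lte01 sube0 mule1.
have mI : (m%:E <= \int[lebesgue_measure]_(t in `]0%R, 1%R[) (g t)%:E)%E.
  rewrite -Ic; apply: le_ge0_integral => t t01; rewrite lee_fin //.
  by have /andP[] := slice t t01.
have IM : (\int[lebesgue_measure]_(t in `]0%R, 1%R[) (g t)%:E <= M%:E)%E.
  rewrite -Ic; apply: le_ge0_integral => t t01; rewrite lee_fin;
  have /andP[mg gM] := slice t t01 => //; exact: le_trans mg.
have If : (\int[lebesgue_measure]_(t in `]0%R, 1%R[) (g t)%:E)%E \is a fin_num.
  by rewrite fin_numE; apply/andP; split; apply/eqP => E; move: mI IM; rewrite E.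
rewrite /Rintegral -2!lee_fin fineK //.
by rewrite mI.
Qed.

(** The modulus of [exp (2 i pi z)] is [exp (- 2 pi Im z)], which forces [z] to
be real; then [cos (2 pi z) = 1] gives [sin (pi z) = 0], whereas [sin] is
positive strictly between 0 and [pi]. *)
Lemma cexp_2ipi_eq1 (z : R[i]) :
  cexp ((0 +i* (2 * pi)) * z) = 1 ->
  complex.Im z = 0 /\ ~ (0 < complex.Re z < 1).
Proof.
case: z => a b; rewrite /cexp /= !mul0r !sub0r add0r => -[].
set e := expR _; set t := 2 * pi * a; rewrite !mul0r subr0 addr0 => ec es.
have e0 : 0 < e by exact: expR_gt0.
have s0 : sin t = 0 by move/eqP: es; rewrite mulf_eq0 gt_eqF //= => /eqP.
have c1 : cos t = 1.
  have := cos2Dsin2 t; rewrite s0 expr0n addr0 => /eqP.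
  rewrite sqrf_eq1 => /orP[/eqP //|/eqP c]; move: ec; rewrite c; lra.
have p0 : 0 < pi :> R by exact: pi_gt0.
split.
  move: ec; rewrite c1 mulr1 /e -[RHS]expR0 => /expR_inj /eqP.
  by rewrite oppr_eq0 !mulf_eq0 pnatr_eq0 (gt_eqF p0) /= => /eqP.
move=> /andP[a0 a1].
have : 0 < sin (pi * a).
  by apply: sin_gt0_pi; rewrite mulr_gt0 //= gtr_pMr.
have -> : sin (pi * a) = 0.
  have tE : t = (pi * a) *+ 2 by rewrite /t -mulr_natl; ring.
  have := cos2Dsin2 (pi * a); move: c1; rewrite tE cos_mulr2n => c1.
  have -> : cos (pi * a) ^+ 2 = 1 by lra.
  move/eqP; rewrite -subr_eq0 addrAC subrr add0r sqrf_eq0 => /eqP //.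
by rewrite ltxx.
Qed.

End Real.

(** * Affine cubes in a chart *)

Section Geometry.
Context {R : realType}.

Lemma diff_linear_translate (V W : normedModType R) (L : {linear V -> W})
    (x : W) (t : V) :
  continuous L -> 'd (fun u => L u + x) t = L :> (V -> W).
Proof.
move=> Lc; have -> : (fun u => L u + x) = (L : V -> W) + cst x by [].
have Ld : differentiable L t by exact: linear_differentiable.
rewrite diffD // diff_lin // diff_cst.
by apply/funext => u /=; rewrite addr0.
Qed.

(** The chain rule in terms of row vectors, hence with the inner Jacobian on the
left.  Equality near [t] is what is available for cubes, which are functions
of the clamped variable. *)
Lemma jacobian_near_comp n m p (h : 'rV[R]_n -> 'rV[R]_m)
    (g : 'rV[R]_m -> 'rV[R]_p) (f : 'rV[R]_n -> 'rV[R]_p) (t : 'rV[R]_n) :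
  differentiable h t -> differentiable g (h t) ->
  (\forall u \near t, f u = g (h u)) ->
  jacobian f t = jacobian h t *m jacobian g (h t).
Proof.
move=> ht gt fgh.
have ght : differentiable (g \o h) t by exact: differentiable_comp.
have df : 'd f t = 'd (g \o h) t :> ('rV[R]_n -> 'rV[R]_p).
  by apply: diff_near_eq => //; apply: filterS fgh.
apply/row_matrixP => l; rewrite !rowE mulmxA !mul_rV_lin1 /= df.
by rewrite diff_comp.
Qed.

Section Affine.
Context {k d : nat}.
Implicit Types (A : 'M[R]_(k, d)) (x : 'rV[R]_d).

Definition affine_param A x (t : 'rV[R]_k) : 'rV[R]_d := t *m A + x.

Lemma mulmxr_differentiable A (t : 'rV[R]_k) :
  differentiable (mulmxr A : 'rV[R]_k -> 'rV[R]_d) t.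
Proof.
have -> : mulmxr A = \sum_(j < k) (fun u : 'rV[R]_k => u 0 j *: row j A) :> (_ -> _).
  by apply/funext => u; rewrite /= mulmx_sum_row fct_sumE.
apply: differentiable_sum => j; apply: differentiableZl.
exact: differentiable_coord.
Qed.

Lemma affine_param_differentiable A x t : differentiable (affine_param A x) t.
Proof. by apply: differentiableD => //; exact: mulmxr_differentiable. Qed.

Lemma diff_affine_param A x t :
  'd (affine_param A x) t = mulmxr A :> ('rV[R]_k -> 'rV[R]_d).
Proof.
have Ac : continuous (mulmxr A : 'rV[R]_k -> 'rV[R]_d).
  by move=> u; apply: differentiable_continuous; exact: mulmxr_differentiable.
exact: (diff_linear_translate (L := mulmxr A)).
Qed.

Lemma jacobian_affine_param A x t : jacobian (affine_param A x) t = A.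
Proof.
by apply/row_matrixP => l; rewrite !rowE mul_rV_lin1 /= diff_affine_param.
Qed.

Lemma Cn_cst (W : normedModType R) (c : W) n : @Cn R k W n setT (cst c).
Proof.
elim: n c => [|n IHn] c /=; first by move=> t _; exact: cst_continuous.
split=> [t _|v]; first exact: differentiable_cst.
have -> : (fun t => 'D_v (cst c) t) = cst (0 : W) by apply/funext => t; rewrite derive_cst.
exact: IHn.
Qed.

Lemma affine_param_smooth A x : smooth_on setT (affine_param A x).
Proof.
split=> [|[|n] /=]; first exact: openT.
  move=> t _; apply: differentiable_continuous; exact: affine_param_differentiable.
split=> [t _|v]; first exact: affine_param_differentiable.
have -> : (fun t => 'D_v (affine_param A x) t) = cst (v *m A).
  apply/funext => t; rewrite deriveE ?diff_affine_param //.
  exact: affine_param_differentiable.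
exact: Cn_cst.
Qed.

(** A coefficient of [t *m A] is bounded by the sum of all the entries of [A] in
absolute value when [t] is in the unit cube. *)
Lemma affine_param_ball A x (a e : R) (t : icube R k) :
  0 < a -> a * (\sum_j \sum_l `|A j l|) < e ->
  ball x e (affine_param (a *: A) x (val t)).
Proof.
move=> a0 Ae; have e0 : 0 < e.
  apply: le_lt_trans Ae; apply: mulr_ge0; first exact: ltW.
  by apply: sumr_ge0 => j _; exact: sumr_ge0.
split=> // i l; rewrite (ord1 i) mxE /ball /= opprD addrCA subrr addr0 normrN.
apply: le_lt_trans Ae; rewrite mxE mulr_sumr.
apply: (le_trans (ler_norm_sum _ _ _)); apply: ler_sum => j _.
rewrite mxE mulrCA normrM gtr0_norm //; apply: ler_wpM2l; first exact: ltW.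
have /forallP/(_ j)/andP[t0 t1] := valP t.
rewrite normrM ger0_norm //; apply: (@le_trans _ _ `|A j l|).
  by rewrite ler_piMl.
by rewrite (bigD1 l) //= lerDl sumr_ge0.
Qed.

End Affine.

Lemma clamp_near_id k (t : 'rV[R]_k) :
  (forall i, 0 < t 0 i < 1) -> \forall u \near t, val (clamp u) = u.
Proof.
move=> t01.
have : \forall u \near t, forall i : 'I_k, (u : 'rV[R]_k) 0 i \in `]0, 1[.
  apply: (@filter_forall _ _ (fun i (u : 'rV[R]_k) => u 0 i \in `]0, 1[)
    _ (@nbhs_filter 'rV[R]_k t)) => i.
  have ti : t 0 i \in `]0, 1[ by rewrite in_itv /= t01.
  exact: (@coord_continuous R 1 k 0 i t _ (near_in_itvoo ti)).
apply: filterS => u u01; apply/rowP => i; rewrite mxE.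
have := u01 i; rewrite in_itv /= => /andP[u0 u1].
by rewrite min_r ?max_r ?ltW.
Qed.

Section Parallelepiped.
Context {d : nat} {X : manifold R d} {k : nat}.
Variables (i : chart X) (A : 'M[R]_(k, d)) (x : 'rV[R]_d).
Hypothesis inr : forall t : icube R k, chart_range i (affine_param A x (val t)).

Lemma chart_paramK y : chart_range i y ->
  chart_domain i (chart_param i y) /\ chart_coord i (chart_param i y) = y.
Proof. by move=> [p ip <-]; rewrite chart_coordK. Qed.

Lemma parallelepiped_smooth :
  smooth_cube (fun t : icube R k => chart_param i (affine_param A x (val t))).
Proof.
move=> p; exists i, setT, (affine_param A x); split=> //.
  exact: affine_param_smooth.
by move=> q _; exact: chart_paramK.
Qed.

(** The cube spanned, in the chart [i], by the rows of [A] at the point of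
coordinates [x]. *)
Definition parallelepiped : cube X k := Cube parallelepiped_smooth.

(** The pullback is computed in a chart [j] that depends on the point; the
transformation rule of the form under a change of charts brings it back to the
chart [i], in which the cube is affine with Jacobian [A]. *)
Lemma pullback_parallelepiped (w : diff_form X k) (t : 'rV[R]_k) :
  (forall l, 0 < t 0 l < 1) ->
  pullback w parallelepiped t = form_at w i (affine_param A x t) A.
Proof.
move=> /clamp_near_id ct; have ctt := nbhs_singleton ct.
rewrite /pullback; set p := parallelepiped (clamp t); set j := chart_at p.
have [ip cp] : chart_domain i p /\ chart_coord i p = affine_param A x t.
  by rewrite -[t in RHS]ctt; exact: (chart_paramK (inr (clamp t))).
have jp : chart_domain j p by exact: mem_chart_at.
rewrite -cp (form_transition w A ip jp); congr (form_at w j _ _).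
set G := chart_coord j \o chart_param i.
have Gd : differentiable G (affine_param A x t).
  by have [_ /(_ 1%N) [+ _]] := transition_smooth i j; apply; exists p.
set F := fun y => _.
rewrite (@jacobian_near_comp _ _ _ (affine_param A x) G F t).
- by rewrite jacobian_affine_param -cp.
- exact: affine_param_differentiable.
- exact: Gd.
- by apply: filterS ct => u cu; rewrite -[u in RHS]cu.
Qed.

End Parallelepiped.

Section Multilinear.
Context {d k : nat}.

Definition scale_row (l : 'I_k) (a : R) (A : 'M[R]_(k, d)) : 'M[R]_(k, d) :=
  \matrix_(m, j) ((if m == l then a else 1) * A m j).

Lemma multilinear_scale_row (w : 'M[R]_(k, d) -> R[i]) l a A :
  multilinear w -> w (scale_row l a A) = a%:C * w A.
Proof.
move=> wm; rewrite (wm _ A A l a 0) ?mul0r ?addr0 //.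
- by rewrite scale0r addr0; apply/rowP => j; rewrite !mxE eqxx.
- by apply/matrixP => m j; rewrite !mxE eq_sym (negbTE (neq_lift _ _)) mul1r.
- by apply/matrixP => m j; rewrite !mxE eq_sym (negbTE (neq_lift _ _)) mul1r.
Qed.

(** Scale the rows one after the other: the matrix in which the rows of index
in [s] have been scaled is obtained from [A] by [size s] single scalings. *)
Lemma multilinear_scale (w : 'M[R]_(k, d) -> R[i]) a A :
  multilinear w -> w (a *: A) = (a ^+ k)%:C * w A.
Proof.
move=> wm.
have E (s : seq 'I_k) : uniq s ->
    \matrix_(m, j) ((if m \in s then a else 1) * A m j) =
    foldr (scale_row^~ a) A s.
  elim: s => [_|l s IHs /= /andP[ls us]].
    by apply/matrixP => m j; rewrite mxE mul1r.
  rewrite -IHs //; apply/matrixP => m j; rewrite !mxE inE.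
  have [->|ml] := eqVneq m l; first by rewrite (negbTE ls) mul1r.
  by rewrite /= mul1r.
have -> : a *: A = foldr (scale_row^~ a) A (enum 'I_k).
  rewrite -E ?enum_uniq //; apply/matrixP => m j.
  by rewrite !mxE mem_enum.
rewrite -[k in a ^+ k](size_enum_ord k).
elim: (enum _) => [|l s IHs] /=; first by rewrite expr0 mul1r.
by rewrite multilinear_scale_row // IHs exprS rmorphM mulrA.
Qed.

End Multilinear.

End Geometry.

(** * Integrals of a nonzero form over small cubes *)

Section SmallCube.
Context {R : realType} {d : nat} {X : manifold R d} {k : nat}.
Variable w : diff_form X k.+1.

(** Here [part] stands for the real or the imaginary part.  Near [x] the value
[part (w v)] lies between one half and three halves of its value [c] at [x];
scaling the rows of [v] by [a] multiplies it by [a ^ k.+1], and a small [a]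
makes the integral smaller than 1 while it stays positive. *)
Lemma small_cube_integral (part : R[i] -> R) (i : chart X) x v :
  (forall a z, part (a%:C * z) = a * part z) ->
  chart_range i x -> {for x, continuous (fun y => part (form_at w i y v))} ->
  0 < part (form_at w i x v) ->
  exists s : cube X k.+1, 0 < open_cube_integral (part \o pullback w s) < 1.
Proof.
move=> partZ ix fc; set f := fun y => part _ in fc; rewrite -/(f x).
set c := f x => c0.
have : \forall y \near x, chart_range i y /\ c / 2 < f y < 3 / 2 * c.
  apply: filterI; first exact: (open_nbhs_nbhs (conj (@open_chart_range _ _ X i) ix)).
  have cI : c \in `]c / 2, 3 / 2 * c[ by rewrite in_itv /=; apply/andP; split; lra.
  have fcI : \forall y \near x, f y \in `]c / 2, 3 / 2 * c[.
    exact: fc _ (near_in_itvoo cI).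
  by apply: filterS fcI => y; rewrite in_itv.
move=> /(@nbhs_ballP R 'rV[R]_d)[e /= e0 xe].
(* The scaling factor is [D^-1]: the terms of [D] ensure that it is at most 1,
that the cube stays in the ball of radius [e], and that [2 * c * D^-1 < 1]. *)
pose S := \sum_j \sum_l `|v j l|; pose D := 1 + S / e + 2 * c.
have S0 : 0 <= S by apply: sumr_ge0 => j _; exact: sumr_ge0.
have Se0 : 0 <= S / e by apply: divr_ge0 => //; exact: ltW.
have D0 : 0 < D by rewrite /D; lra.
have a0 : 0 < D^-1 by rewrite invr_gt0.
have aS : D^-1 * S < e.
  by rewrite mulrC ltr_pdivrMr // mulrC -ltr_pdivrMr // /D; lra.
have xin (t : icube R k.+1) := xe _ (affine_param_ball x t a0 aS).
exists (parallelepiped (fun t => (xin t).1)).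
have ak : 0 < D^-1 ^+ k.+1 by rewrite exprn_gt0.
have ak1 : D^-1 ^+ k.+1 * (2 * c) < 1.
  have aD : D^-1 * (2 * c) < 1 by rewrite mulrC ltr_pdivrMr // /D; lra.
  apply: le_lt_trans aD; rewrite ler_pM2r; last by lra.
  by rewrite exprS ler_piMr ?exprn_ile1 ?invf_le1 // ?ltW // /D; lra.
have /andP[lo hi] : D^-1 ^+ k.+1 * (c / 2) <=
    open_cube_integral (part \o pullback w (parallelepiped (fun t => (xin t).1)))
    <= D^-1 ^+ k.+1 * (3 / 2 * c).
  apply: open_cube_integral_itv => [|t t01].
    by apply: mulr_ge0; [exact: ltW | lra].
  rewrite /= pullback_parallelepiped //.
  have ctt := nbhs_singleton (clamp_near_id t01).
  have [tr /andP[f1 f2]] := xin (clamp t); rewrite ctt in tr f1 f2.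
  rewrite multilinear_scale ?partZ; last exact: form_multilinear.
  by rewrite !ler_pM2l // !ltW.
apply/andP; split.
  by apply: lt_le_trans lo; apply: mulr_gt0 => //; lra.
apply: le_lt_trans hi _; apply: lt_trans ak1.
by rewrite ltr_pM2l //; lra.
Qed.

(** If the real part of [w] is nonzero, its integral over a small cube lies
strictly between 0 and 1; otherwise the imaginary part is nonzero, and so is
its integral over a small cube.  The conclusion covers both cases, and is
incompatible with [cexp_2ipi_eq1]. *)
Lemma nonzero_form_integral i x v :
  chart_range i x -> form_at w i x v != 0 ->
  exists s : cube X k.+1, complex.Im (cube_integral w s) = 0 ->
    0 < complex.Re (cube_integral w s) < 1.
Proof.
move=> ix wv0.
have key (part : R[i] -> R) :
    (forall a z, part (a%:C * z) = a * part z) ->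
    (forall u, {for x, continuous (fun y => part (form_at w i y u))}) ->
    part (form_at w i x v) != 0 ->
    exists s : cube X k.+1, 0 < open_cube_integral (part \o pullback w s) < 1.
  move=> partZ fc; rewrite neq_lt => /orP[neg|pos]; last first.
    exact: small_cube_integral pos.
  (* Changing the sign of one vector makes the value positive. *)
  apply: (@small_cube_integral part i x (scale_row ord0 (-1) v)) => //.
  rewrite multilinear_scale_row ?partZ; last exact: form_multilinear.
  by rewrite mulN1r oppr_gt0.
have ReZ a z : complex.Re (a%:C * z) = a * complex.Re z :> R.
  by case: z => p q; rewrite /= mul0r subr0.
have ImZ a z : complex.Im (a%:C * z) = a * complex.Im z :> R.
  by case: z => p q; rewrite /= mul0r addr0.
have [Re0|Re0] := eqVneq (complex.Re (form_at w i x v)) 0.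
  have Im0 : complex.Im (form_at w i x v) != 0.
    by apply: contraNneq wv0 => Im0; rewrite eq_complex Re0 Im0 eqxx.
  have [|s /andP[s0 _]] := key _ ImZ _ Im0.
    by move=> u; have [_ [_ uc]] := form_smooth w i u; exact: uc 0%N x ix.
  exists s => Im_s; move: s0.
  by rewrite -[open_cube_integral _]/(complex.Im (cube_integral w s)) Im_s ltxx.
have [|s s01] := key _ ReZ _ Re0.
  by move=> u; have [[_ uc] _] := form_smooth w i u; exact: uc 0%N x ix.
by exists s.
Qed.

End SmallCube.

(** * Morphisms that differ by a boundary *)

Section Functor.
Context {R : realType} {d : nat} {X : manifold R d} {n : nat}.
Variable E : sym_monoidal_functor X n.

Lemma fun_unit_inj : injective (fun_unit E).
Proof.
move=> z z' zz'; have := fun_unit_dot E z 1.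
by rewrite zz' fun_unit_dot rmorph1 !mulr1.
Qed.

(** As chains, [a2 = boundary b + a1], and the unit isomorphisms are zero
chains, so that the tensor product of [boundary b] and [a1], followed by the
unit isomorphism at [h], equals the unit isomorphism at [g] followed by [a2].
Apply both to the tensor product of the unit vector with [u]. *)
Lemma fun_mor_shift (g h : obj X n) (a1 a2 : mor g h) (b : chain X n.+2) :
  boundary b = - val a1 + val a2 ->
  fun_mor E (mor_boundary b) (fun_unit E 1) = fun_unit E 1 ->
  fun_mor E a1 =1 fun_mor E a2.
Proof.
move=> bE b1 u.
have sq : mor_comp (mor_tensor (mor_boundary b) a1) (mor_eq (add0r h)) =
          mor_comp (mor_eq (add0r g)) a2.
  apply/val_inj; rewrite /= bE addr0 add0r.
  by rewrite addrAC addNr add0r.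
rewrite -[u in RHS]fun_unitl -[RHS]/((_ \o _) _) -fun_mor_comp -sq.
by rewrite fun_mor_comp /= fun_tensor_natural b1 fun_unitl.
Qed.

End Functor.

(** * Integrals of forms over chains *)

Lemma pullback_eq0 (R : realType) d (X : manifold R d) k (w : diff_form X k)
    (s : cube X k) : form_eq0 w -> pullback w s = fun=> 0.
Proof.
move=> w0; apply/funext => t; apply: w0.
exists (s (clamp t)) => //; exact: mem_chart_at.
Qed.

Lemma chain_integral_eq0 (R : realType) d (X : manifold R d) k
    (w : diff_form X k) (b : chain X k) : form_eq0 w -> chain_integral w b = 0.
Proof.
move=> w0; rewrite /chain_integral /free_integral big1 // => s _.
have I0 m : open_cube_integral (fun _ : 'rV[R]_m => 0) = 0.
  by elim: m => //= m ->; rewrite Rintegral_cst // mul0r.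
by rewrite /cube_integral pullback_eq0 // !I0 mul0rz.
Qed.

Lemma chain_integral_cube (R : realType) d (X : manifold R d) k
    (w : diff_form X k) (s : cube X k) :
  chain_integral w (\pi_(chain X k)%qT << s >>) = cube_integral w s.
Proof.
by rewrite chain_integral_pi /free_integral domU1 big_seq1 coeffU eqxx.
Qed.

(** * Flatness and invariance *)

Theorem proposition3p1 (R : realType) (d : nat) (X : manifold R d) (n : nat)
    (E : chain_field_theory X n) :
  flat E <-> deformation_invariant E.
Proof.
split=> [E0 g h a1 a2 b bE|Einv i x v ix].
  apply: (fun_mor_shift bE); rewrite holonomy chain_integral_eq0 //.
  by rewrite mulr0 /cexp expR0 cos0 sin0 mul1r.
apply/eqP; apply: contraT => /(nonzero_form_integral ix)[s sI].
pose b := \pi_(chain X n.+2)%qT << s >> : chain X n.+2.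
have b1 : fun_mor E (mor_boundary b) (fun_unit E 1) = fun_unit E 1.
  rewrite -[RHS]fun_mor_id; symmetry; apply: (Einv _ _ _ _ b).
  by rewrite /= oppr0 add0r.
(* [fun_unit] is injective, so the holonomy formula gives an equation in [C]. *)
have [] := cexp_2ipi_eq1 (fun_unit_inj (etrans (esym (holonomy E b)) b1)).
by rewrite chain_integral_cube => /sI.
Qed.
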